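(* Let $f:\mathbb{R}^d\to[0,\infty)$ be Lipschitz continuous with Lipschitz constant $L_f>0$, let the random process $\{x^{i,k}\}_{i=1}^N$, $k\ge0$, be generated by the ESCBO algorithm, and suppose that $$(1-\lambda)^2+\delta^2<\frac12\quad\text{and}\quad \sum_{k=0}^\infty\alpha_k<\infty.$$ Then there exists a random vector $x_\infty$ such that $$\lim_{k\to\infty}x^{i,k}=x_\infty\quad\text{almost surely, for all } i\in[N].$$
   Context: $[N]=\{1,\dots,N\}$; $\odot$ is the componentwise (Hadamard) product; $e_l$ is the $l$-th column of the identity matrix. Forward-difference gradient estimator with interval $\sigma>0$: $g(x)\in\mathbb{R}^d$ with $[g(x)]_l=\frac{f(x+\sigma e_l)-f(x)}{\sigma}$, $l\in[d]$. ESCBO algorithm: given $N$, initial points $x^{i,0}\in\mathbb{R}^d$ ($i\in[N]$), parameters $\beta>0$, $\lambda>0$, $\delta\ge0$, $\sigma>0$ and a nonnegative sequence $\{\alpha_k\}_{k\ge0}$, for $k=0,1,2,\dots$ set $$\bar x^{\star,k}=\frac{\sum_{i=1}^N x^{i,k}\mathrm{e}^{-\beta f(x^{i,k})}}{\sum_{i=1}^N \mathrm{e}^{-\beta f(x^{i,k})}},$$ draw a random vector $\eta^k=(\eta^k_1,\dots,\eta^k_d)^\top$ with i.i.d. components $\eta^k_l\sim\mathcal{N}(0,\delta^2)$ (the same $\eta^k$ is used for all particles; the vectors $\eta^0,\eta^1,\dots$ are mutually independent), and for every $i\in[N]$ set $$y^{i,k+1}=x^{i,k}-\lambda(x^{i,k}-\bar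 x^{\star,k})-(x^{i,k}-\bar x^{\star,k})\odot\eta^k,\qquad x^{i,k+1}=y^{i,k+1}-\alpha_k\,g(x^{i,k}).$$ *)

(* Defs.v *)
From HB Require Import structures.
From mathcomp Require Import all_boot all_order all_algebra.
From mathcomp Require Import all_classical all_reals all_analysis.
Import Order.TTheory GRing.Theory Num.Theory.
Import numFieldNormedType.Exports.

Set Implicit Arguments.
Unset Strict Implicit.
Unset Printing Implicit Defensive.

Local Open Scope classical_set_scope.
Local Open Scope ring_scope.

(* Product sigma-algebra on row vectors, built exactly as the library builds the
   one on n.-tuple T. On R^n it is the Borel sigma-algebra, so that
   {RV P >-> 'rV[R]_n} is the type of random vectors. *)
Definition measure_row_display : measure_display -> measure_display.
Proof. exact. Qed.

Section measurable_row.
Context {d} {T : sigmaRingType d} (n : nat).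

Let coors : 'I_n -> 'rV[T]_n -> T := fun i x => x ord0 i.

Let row_set0 : g_sigma_preimage coors set0.
Proof. exact: sigma_algebra0. Qed.

Let row_setC A : g_sigma_preimage coors A -> g_sigma_preimage coors (~` A).
Proof. exact: sigma_algebraC. Qed.

Let row_bigcup (F : (set 'rV[T]_n)^nat) :
  (forall i, g_sigma_preimage coors (F i)) ->
  g_sigma_preimage coors (\bigcup_i (F i)).
Proof. exact: sigma_algebra_bigcup. Qed.

HB.instance Definition _ := @isMeasurable.Build (measure_row_display d)
  'rV[T]_n (g_sigma_preimage coors) row_set0 row_setC row_bigcup.

End measurable_row.

Section probability_notions.
Context {d d'} {T : measurableType d} {T' : measurableType d'} {R : realType}.

Definition mutually_independent (P : probability T R) (I : eqType)
    (X : I -> T -> T') : Prop :=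
  forall (J : seq I) (B : I -> set T'), uniq J ->
    (forall j, measurable (B j)) ->
    P (\bigcap_(j in [set` J]) X j @^-1` B j)
    = (\prod_(j <- J) P (X j @^-1` B j))%E.

End probability_notions.

(* N(m, s^2). The library's normal_prob m s is the Gaussian law only for
   s != 0 (for s = 0 it is the uniform law on [0, 1]), whereas N(m, 0) is the
   point mass at m. *)
Definition gaussian_law {R : realType} (m s : R) (A : set R) : \bar R :=
  if s == 0 then \d_m A else normal_prob m s A.

Section escbo.
Context {R : realType} {d N : nat}.
Implicit Types (f : 'rV[R]_d -> R) (u v x : 'rV[R]_d) (X : 'I_N -> 'rV[R]_d).

Definition euclidean_norm u : R := Num.sqrt (\sum_(l < d) u ord0 l ^+ 2).

Definition lipschitz_with (L : R) f : Prop :=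
  forall x y, `|f x - f y| <= L * euclidean_norm (x - y).

Definition hadamard u v : 'rV[R]_d := map2_mx *%R u v.

Definition fd_gradient f (sigma : R) x : 'rV[R]_d :=
  \row_(l < d) ((f (x + sigma *: delta_mx ord0 l) - f x) / sigma).

Definition consensus_point f (beta : R) X : 'rV[R]_d :=
  (\sum_(i < N) expR (- (beta * f (X i))))^-1 *:
  \sum_(i < N) expR (- (beta * f (X i))) *: X i.

Definition escbo_step f (beta lambda sigma a : R) (e : 'rV[R]_d) X :
    'I_N -> 'rV[R]_d := fun i =>
  let xbar := consensus_point f beta X in
  let y := X i - lambda *: (X i - xbar) - hadamard (X i - xbar) e in
  y - a *: fd_gradient f sigma (X i).

(* Trajectory driven by a realization e of the noise vectors. *)
Fixpoint escbo f (beta lambda sigma : R) (alpha : nat -> R)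
    (x0 : 'I_N -> 'rV[R]_d) (e : nat -> 'rV[R]_d) (k : nat) :
    'I_N -> 'rV[R]_d :=
  if k is j.+1 then
    escbo_step f beta lambda sigma (alpha j) (e j)
      (escbo f beta lambda sigma alpha x0 e j)
  else x0.

End escbo.

Definition escbo_noise {disp} {T : measurableType disp} {R : realType} {d : nat}
    (P : probability T R) (delta : R) (eta : nat -> {RV P >-> 'rV[R]_d}) : Prop :=
  [/\ forall k l (A : set R), measurable A ->
        pushforward P (fun w => eta k w ord0 l) A = gaussian_law 0 delta A,
      forall k, mutually_independent P (fun (l : 'I_d) w => eta k w ord0 l)
    & mutually_independent P (fun k w => eta k w)].

(* Main.v *)
(* Fix a coordinate l. Subtracting two updates cancels the consensus point, so
   every gap |x^{i,k}_l - x^{j,k}_l| is bounded by v_k, where v_0 is a constant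
   and v_{k+1} = |1 - lambda - eta^k_l| v_k + 2 Lf alpha_k. As v_k only involves
   eta^0, ..., eta^{k-1}, it is independent of eta^k, hence
   E v_{k+1} = E|1 - lambda - eta^k_l| E v_k + 2 Lf alpha_k. The contraction
   hypothesis gives |1 - lambda| + delta < 1, so the E v_k, and almost surely
   the v_k, are summable. Both the gaps and the increments of x^{i,k}_l
   (at most v_k + v_{k+1}) are controlled by v, so all particles converge to a
   common limit. *)
Require Import Defs.
From HB Require Import structures.
From mathcomp Require Import all_boot all_order all_algebra.
From mathcomp Require Import all_classical all_reals all_analysis.
From mathcomp Require Import measurable_realfun ring lra.

Import Order.TTheory GRing.Theory Num.Theory.
Import numFieldNormedType.Exports.

Local Open Scope classical_set_scope.
Local Open Scope ring_scope.

Import HBNNSimple.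

(** * Change of variables and factorization of expectations *)

(** The hypothesis on [nu] is the claim for indicators; simple functions and monotone convergence
    extend it to [h]. One statement covers measures with a density ([X] the identity), image
    measures ([g] constant 1) and independence ([nu] a multiple of the law of [X]). *)
Lemma ge0_integral_density d d' (T : measurableType d) (T' : measurableType d')
    (R : realType) (mu : {measure set T -> \bar R})
    (nu : {measure set T' -> \bar R}) (X : T -> T') (g : T -> R)
    (h : T' -> \bar R) :
  measurable_fun setT X -> measurable_fun setT g -> (forall x, 0 <= g x) ->
  (forall B, measurable B -> nu B = \int[mu]_(x in X @^-1` B) (g x)%:E)%E ->
  measurable_fun setT h -> (forall y, 0 <= h y)%E ->
  (\int[nu]_y h y = \int[mu]_x (h (X x) * (g x)%:E))%E.
Proof.
move=> mX mg g0 nuE mh h0.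
have mgE : measurable_fun setT (EFin \o g) by exact/measurable_EFinP.
pose u := nnsfun_approx measurableT mh.
have uE y : h y = limn (fun n => (u n y)%:E).
  by apply/esym/cvg_lim => //; exact: cvg_nnsfun_approx.
have ndu n m y : (n <= m)%N -> u n y <= u m y.
  by move=> nm; exact/lefP/nd_nnsfun_approx.
have muX n : measurable_fun setT (fun x => (u n (X x))%:E).
  by apply/measurable_EFinP; exact: measurableT_comp.
transitivity (limn (fun n => \int[nu]_y (u n y)%:E))%E.
  rewrite -monotone_convergence//.
  - by apply: eq_integral => y _; rewrite uE.
  - by move=> n; exact/measurable_EFinP.
  - by move=> n y _; rewrite lee_fin.
  - by move=> y _ n m nm; rewrite lee_fin ndu.
transitivity (limn (fun n => \int[mu]_x ((u n (X x))%:E * (g x)%:E)))%E; last first.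
  rewrite -monotone_convergence//.
  - apply: eq_integral => x _; apply/cvg_lim => //; apply: cvgeZr => //.
    by apply: (cvg_nnsfun_approx measurableT mh) => //.
  - by move=> n; exact: emeasurable_funM.
  - by move=> n x _; rewrite mule_ge0 ?lee_fin.
  - by move=> x _ n m nm; rewrite lee_wpmul2r ?lee_fin ?ndu.
congr (limn _); apply/funext => n.
have mI r : measurable_fun setT (fun x => (\1_(u n @^-1` [set r]) (X x) : R)).
  by apply: measurableT_comp.
transitivity (\sum_(r \in range (u n)) r%:E * nu (u n @^-1` [set r]))%E.
  under eq_integral do rewrite fimfunE -fsumEFin//.
  rewrite ge0_integral_fsum//; last 2 first.
  - by move=> r; exact/measurable_EFinP/measurable_funM.
  - by move=> r y _; rewrite nnfun_muleindic_ge0.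
  by apply: eq_fsbigr => r _; rewrite integralZl_indic_nnsfun// integral_indic// setIT.
(* The indicator of a level set times [g] is [g] restricted to the preimage of that set, whose
   integral is exactly what [nuE] evaluates. *)
transitivity (\int[mu]_x (\sum_(r \in range (u n))
    r%:E * ((g \_ (X @^-1` (u n @^-1` [set r]))) x)%:E))%E; last first.
  apply: eq_integral => x _.
  rewrite fimfunE -fsumEFin// ge0_mule_fsuml; last first.
    by move=> r; exact: nnfun_muleindic_ge0.
  apply: eq_fsbigr => r _; rewrite EFinM -muleA; congr (_ * _)%E.
  by rewrite -EFinM patch_indic mulrC.
have mXB r : measurable (X @^-1` (u n @^-1` [set r])).
  by rewrite -[X @^-1` _]setTI; apply: mX.
have mp r : measurable_fun setT (EFin \o (g \_ (X @^-1` (u n @^-1` [set r])))).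
  apply/measurable_EFinP/(measurable_restrictT _ _).1 => //.
  exact: measurable_funTS.
rewrite ge0_integral_fsum//; last 2 first.
- by move=> r; apply: emeasurable_funM => //; exact: mp.
- move=> r x _; rewrite patch_indic /= -EFinM lee_fin.
  rewrite mulrCA mulr_ge0//; have := nnfun_muleindic_ge0 (u n) r (X x).
  by rewrite lee_fin.
(* Here [r] is a value of [u n], hence nonnegative, so it can be pulled out of the integral. *)
apply: eq_fsbigr => r; rewrite inE => -[y _ <-].
rewrite ge0_integralZl//=; first last.
- by rewrite lee_fin.
- by move=> x _; rewrite lee_fin patch_indic mulr_ge0.
- exact: mp.
congr (_ * _)%E; rewrite nuE// integral_mkcond; apply: eq_integral => x _.
by rewrite /patch; case: ifP.
Qed.

(** The image under [X] of the measure with density [g] is [c] times the law of [X]. This factorizes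
    an expectation without joint laws: checking [g] against the events of [X] is enough. *)
Lemma ge0_integral_independent d d' (T : measurableType d)
    (T' : measurableType d') (R : realType) (P : probability T R)
    (X : {RV P >-> T'}) (g : T -> R) (h : T' -> R) (c : R) :
  measurable_fun setT g -> (forall x, 0 <= g x) -> 0 <= c ->
  (forall B, measurable B ->
    \int[P]_(x in X @^-1` B) (g x)%:E = c%:E * P (X @^-1` B))%E ->
  measurable_fun setT h -> (forall y, 0 <= h y) ->
  (\int[P]_x (h (X x) * g x)%:E = c%:E * \int[P]_x (h (X x))%:E)%E.
Proof.
move=> mg g0 c0 gE mh h0.
pose nu := mscale (NngNum c0) (distribution P X).
have mhE : measurable_fun setT (EFin \o h) by exact/measurable_EFinP.
transitivity (\int[nu]_y (h y)%:E)%E.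
  rewrite (@ge0_integral_density _ _ _ _ _ P nu X g (EFin \o h))//.
  by move=> B mB; rewrite gE.
rewrite ge0_integral_mscale//; last by move=> y _; rewrite lee_fin.
by rewrite ge0_integral_distribution// => y; rewrite lee_fin.
Qed.

(** * First absolute moment of a centred Gaussian *)

(* Bounds [`|x|] by comparing with a slightly wider Gaussian:
   [1 + a x^2 <= expR (a x^2)], and multiplying [normal_pdf 0 delta] by
   [expR (a x^2)] gives [s / delta] times [normal_pdf 0 s]. *)
Lemma normal_pdf_abs_le (R : realType) (delta s a x : R) : 0 < delta -> delta < s ->
  a = (delta ^- 2 - s ^- 2) / 2 ->
  2 * s * `|x| * normal_pdf 0 delta x + a^-1 * normal_pdf 0 delta x <=
  s / (delta * a) * normal_pdf 0 s x + s ^+ 2 * normal_pdf 0 delta x.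
Proof.
move=> delta0 deltas aE; have s0 : 0 < s by exact: lt_trans deltas.
have a0 : 0 < a.
  by rewrite aE divr_gt0// subr_gt0 ltf_pV2 ?posrE ?exprn_gt0// ltr_pXn2r ?nnegrE ?ltW.
have peakE t : 0 < t -> normal_peak t = t^-1 * (Num.sqrt (pi *+ 2))^-1.
  move=> t0; rewrite /normal_peak -mulrnAr sqrtrM ?sqr_ge0// sqrtr_sqr.
  by rewrite gtr0_norm// invfM.
rewrite /normal_pdf !gt_eqF//= !peakE//.
set c := (Num.sqrt _)^-1; have c0 : 0 < c.
  by rewrite invr_gt0 sqrtr_gt0 mulrn_wgt0// pi_gt0.
have -> : normal_fun 0 s x = expR (a * x ^+ 2) * normal_fun 0 delta x.
  rewrite /normal_fun -expRD; congr expR; rewrite subr0 aE.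
  by field; rewrite !gt_eqF.
set e := normal_fun 0 delta x; have e0 : 0 < e by exact: expR_gt0.
have H : 2 * s * `|x| + a^-1 <= a^-1 * expR (a * x ^+ 2) + s ^+ 2.
  have h1 : 1 + a * x ^+ 2 <= expR (a * x ^+ 2) by exact: expR_ge1Dx.
  have h2 : a^-1 + x ^+ 2 <= a^-1 * expR (a * x ^+ 2).
    rewrite -ler_pdivrMl ?invr_gt0// invrK mulrDr divff ?gt_eqF//.
  (* Expanding the square gives 2 s |x| <= x^2 + s^2, the source of the term [s ^+ 2] in the
     statement. *)
  have h3 : 0 <= (`|x| - s) ^+ 2 by exact: sqr_ge0.
  have h4 : `|x| ^+ 2 = x ^+ 2 by exact: real_normK (num_real _).
  by move: h3; rewrite sqrrB h4; lra.
rewrite -mulrDl.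
have -> : s / (delta * a) * (s^-1 * c * (expR (a * x ^+ 2) * e)) +
   s ^+ 2 * (delta^-1 * c * e) =
   (a^-1 * expR (a * x ^+ 2) + s ^+ 2) * (delta^-1 * c * e).
  by field; rewrite !gt_eqF.
rewrite ler_wpM2r// !mulr_ge0 ?invr_ge0//; exact: ltW.
Qed.

(** Integrating [normal_pdf_abs_le] gives 2 s I + 1/a <= s/(delta a) + s^2 for the moment I. The
    choice of [a] makes s/(delta a) - 1/a equal to 2 delta s^2/(s + delta), which is at most s^2;
    hence I <= s. Keeping 1/a on the left leaves only nonnegative integrands. *)
Lemma normal_prob_abs_le (R : realType) (delta s : R) : 0 < delta -> delta < s ->
  (\int[normal_prob 0 delta]_x `|x|%:E <= s%:E)%E.
Proof.
move=> delta0 deltas; have s0 : 0 < s by exact: lt_trans deltas.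
pose a := (delta ^- 2 - s ^- 2) / 2.
have a0 : 0 < a.
  by rewrite divr_gt0// subr_gt0 ltf_pV2 ?posrE ?exprn_gt0// ltr_pXn2r ?nnegrE ?ltW.
have mpdf t : measurable_fun setT (fun x => (normal_pdf 0 t x)%:E : \bar R).
  by apply/measurable_EFinP; exact: measurable_normal_pdf.
have mabs : measurable_fun setT (fun x : R => `|x|%:E).
  by apply/measurable_EFinP; exact: normr_measurable.
rewrite (@ge0_integral_density _ _ _ _ _ lebesgue_measure (normal_prob 0 delta)
  idfun (normal_pdf 0 delta))//; last 3 first.
- exact: measurable_id.
- exact: measurable_normal_pdf.
- by move=> x; exact: normal_pdf_ge0.
set I := (\int[_]_x _)%E.
have I0 : (0 <= I)%E.
  by apply: integral_ge0 => x _; rewrite -EFinM lee_fin mulr_ge0// normal_pdf_ge0.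
have : ((2 * s)%:E * I + a^-1%:E <= (s / (delta * a) + s ^+ 2)%:E)%E.
  rewrite /I -ge0_integralZl//=; first last.
  - by rewrite lee_fin mulr_ge0// ltW.
  - by move=> x _; rewrite -EFinM lee_fin mulr_ge0// normal_pdf_ge0.
  - by apply: emeasurable_funM => //; exact: mpdf.
  (* Each constant is written as a multiple of the integral of a Gaussian density, so that both
     sides become integrals to be compared pointwise. *)
  have Z t k : 0 <= k ->
      k%:E = (\int[lebesgue_measure]_x (k%:E * (normal_pdf 0 t x)%:E))%E :> \bar R.
    move=> k0; rewrite ge0_integralZl// ?integral_normal_pdf ?mule1//.
      exact: mpdf.
    by move=> x _; rewrite lee_fin normal_pdf_ge0.
  have c1 : 0 <= a^-1 by rewrite invr_ge0 ltW.
  have c2 : 0 <= s / (delta * a).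
    by apply: divr_ge0; [exact: ltW|apply: mulr_ge0; exact: ltW].
  have c3 : 0 <= s ^+ 2 by exact: sqr_ge0.
  rewrite EFinD (Z delta _ c1) (Z s _ c2) (Z delta _ c3).
  have M k t : measurable_fun setT
      (fun x => (k%:E * (normal_pdf 0 t x)%:E)%E : \bar R).
    by apply: emeasurable_funM => //; exact: mpdf.
  have N k t (x : R) : 0 <= k -> (0 <= k%:E * (normal_pdf 0 t x)%:E)%E.
    by move=> k0; rewrite mule_ge0 ?lee_fin ?normal_pdf_ge0.
  have M2 : measurable_fun setT
      (fun x : R => ((2 * s)%:E * (`|idfun x|%:E * (normal_pdf 0 delta x)%:E))%E).
    by apply: emeasurable_funM => //; apply: emeasurable_funM => //; exact: mpdf.
  have N2 (x : R) :
      (0 <= (2 * s)%:E * (`|idfun x|%:E * (normal_pdf 0 delta x)%:E))%E.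
    by rewrite -!EFinM lee_fin !mulr_ge0 ?normal_pdf_ge0// ltW.
  rewrite -!ge0_integralD//;
    try by [exact: M|exact: M2|move=> x _; exact: N|move=> x _; exact: N2].
  apply: ge0_le_integral => //.
  - by move=> x _; apply: adde_ge0; [exact: N2|exact: N].
  - by apply: emeasurable_funD; [exact: M2|exact: M].
  - by apply: emeasurable_funD; exact: M.
  - move=> x _ /=; rewrite -!EFinM -!EFinD lee_fin mulrA.
    exact: normal_pdf_abs_le.
(* Integrability was not known beforehand: the finite right-hand side is what rules out an infinite
   moment. *)
case: I I0 => [r| |]//; rewrite ?lee_fin; last first.
  by move=> _; rewrite gt0_muley// lte_fin mulr_gt0.
move=> r0 H.
have E1 : s / (delta * a) - a^-1 = 2 * delta * s ^+ 2 / (s + delta).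
  have sd0 : 0 < s + delta by exact: addr_gt0.
  have n0 : 0 < s ^+ 2 - delta ^+ 2 by rewrite subr_sqr mulr_gt0 ?subr_gt0.
  rewrite /a; field.
  by rewrite ?mulN1r !(gt_eqF s0, gt_eqF delta0, gt_eqF sd0, gt_eqF n0).
have E2 : 2 * delta * s ^+ 2 / (s + delta) <= s ^+ 2.
  rewrite ler_pdivrMr ?addr_gt0// mulrC ler_wpM2l ?sqr_ge0//; lra.
have : 2 * s * r <= 2 * s * s by move: H E1 E2; rewrite expr2; lra.
by rewrite ler_pM2l// mulr_gt0.
Qed.

Lemma gaussian_law_abs_le d (T : measurableType d) (R : realType)
    (P : probability T R) (X : T -> R) (delta s : R) :
  measurable_fun setT X -> 0 <= delta -> delta < s ->
  (forall A, measurable A -> pushforward P X A = gaussian_law 0 delta A) ->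
  (\int[P]_w `|X w|%:E <= s%:E)%E.
Proof.
move=> mX delta0 deltas law.
have lawE (nu : probability (measurableTypeR R) R) :
    (forall A, measurable A -> gaussian_law 0 delta A = nu A) ->
    (\int[P]_w `|X w|%:E = \int[nu]_x `|x|%:E)%E.
  move=> nuE.
  rewrite (@ge0_integral_density _ _ _ _ _ P nu X (cst 1))//=.
  - by apply: eq_integral => w _; rewrite mule1.
  - move=> B mB; rewrite -nuE// -law// integral_cst ?mul1e//.
    by rewrite -[_ @^-1` _]setTI; exact: mX.
  - by apply/measurable_EFinP; exact: normr_measurable.
(* For [delta = 0] the law is the point mass at 0, whose moment vanishes; otherwise it is a genuine
   Gaussian. *)
have [d0|d0] := eqVneq delta 0.
  rewrite (lawE \d_(0 : measurableTypeR R)) => [|A mA]; last first.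
    by rewrite /gaussian_law d0 eqxx.
  rewrite integral_dirac ?diracT ?mul1e//= ?normr0 ?lee_fin; last 2 first.
    by rewrite ltW// -d0.
  by apply/measurable_EFinP; exact: normr_measurable.
rewrite (lawE (normal_prob 0 delta)) => [|A mA]; last first.
  by rewrite /gaussian_law (negbTE d0).
by apply: normal_prob_abs_le => //; rewrite lt_neqAle eq_sym d0.
Qed.

(** * Summability of affine recursions with independent random coefficients *)

(** With random [a] this is the bound v_k on the gaps; with [a] replaced by its means it is the
    expectation of v_k. *)
Fixpoint affine_recursion (R : pzRingType) (M : R) (c a : nat -> R) (k : nat) : R :=
  if k is j.+1 then a j * affine_recursion R M c a j + c j else M.

Lemma affine_recursion_ge0 (R : realDomainType) (M : R) (c a : nat -> R) :
  0 <= M -> (forall k, 0 <= c k) -> (forall k, 0 <= a k) ->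
  forall k, 0 <= affine_recursion R M c a k.
Proof. by move=> M0 c0 a0; elim=> //= k IH; rewrite addr_ge0 ?mulr_ge0. Qed.

(** The partial sums satisfy S_(n+1) <= M + q S_n + C, and the bound is the fixed point of the map D
    -> M + q D + C. *)
Lemma sum_affine_recursion_le (R : realFieldType) (M C q : R) (c a : nat -> R) :
  0 <= M -> q < 1 -> (forall k, 0 <= c k) -> (forall k, 0 <= a k <= q) ->
  (forall n, \sum_(0 <= k < n) c k <= C) ->
  forall n, \sum_(0 <= k < n) affine_recursion R M c a k <= (M + C) / (1 - q).
Proof.
move=> M0 q1 c0 a0q cC.
have a0 k : 0 <= a k by case/andP: (a0q k).
have C0 : 0 <= C by have := cC 0%N; rewrite big_geq.
set D := (M + C) / (1 - q); have q1' : 0 < 1 - q by rewrite subr_gt0.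
have DE : M + q * D + C = D by rewrite /D; field; rewrite gt_eqF.
elim=> [|n IH]; first by rewrite big_geq//; apply: divr_ge0; [exact: addr_ge0|exact: ltW].
have q0 : 0 <= q by case/andP: (a0q 0%N) => /le_trans; apply.
rewrite big_nat_recl//= -DE -addrA lerD2l big_split/= lerD//.
apply: (le_trans (y := q * \sum_(0 <= k < n) affine_recursion R M c a k)).
  rewrite mulr_sumr ler_sum// => k _; rewrite ler_wpM2r//.
    exact: affine_recursion_ge0.
  by case/andP: (a0q k).
by rewrite ler_wpM2l.
Qed.

Section independent_recursion.
Context d d' (T : measurableType d) (T' : measurableType d') (R : realType)
  (P : probability T R) (X : nat -> {RV P >-> T'}) (h : T' -> R) (M q : R)
  (c : nat -> R).
Hypotheses (indepX : mutually_independent P (fun k w => X k w))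
  (mh : measurable_fun setT h) (h0 : forall y, 0 <= h y)
  (M0 : 0 <= M) (c0 : forall k, 0 <= c k)
  (Ehq : forall k, (\int[P]_w (h (X k w))%:E <= q%:E)%E).

Let V k w := affine_recursion R M c (fun j => h (X j w)) k.
Let e k := fine (\int[P]_w (h (X k w))%:E).
Let cyl (J : seq nat) (B : nat -> set T') := \bigcap_(j in [set` J]) X j @^-1` B j.

Let mhX k : measurable_fun setT (fun w => h (X k w)).
Proof. exact: measurableT_comp. Qed.

Let V0 k w : 0 <= V k w. Proof. exact: affine_recursion_ge0. Qed.

Let mV k : measurable_fun setT (V k).
Proof.
by elim: k => [|k IH]; [exact: measurable_cst|
  apply: measurable_funD => //; exact: measurable_funM].
Qed.

Let Eh0 k : (0 <= \int[P]_w (h (X k w))%:E)%E.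
Proof. by apply: integral_ge0 => w _; rewrite lee_fin. Qed.

Let eE k : (\int[P]_w (h (X k w))%:E = (e k)%:E)%E.
Proof.
by rewrite fineK// ge0_fin_numE// (le_lt_trans (Ehq k))// ltry.
Qed.

Let e0 k : 0 <= e k. Proof. by rewrite -lee_fin -eE. Qed.

Let mX k (B : set T') : measurable B -> measurable (X k @^-1` B).
Proof. by move=> mB; rewrite -[_ @^-1` _]setTI; exact: measurable_funP. Qed.

Let mcyl J B : (forall j, measurable (B j)) -> measurable (cyl J B).
Proof.
move=> mB; apply: fin_bigcap_measurable => [|j _]; first exact: finite_seq.
exact: mX.
Qed.

Let cyl_cons k J B : cyl (k :: J) B = X k @^-1` B k `&` cyl J B.
Proof.
apply/seteqP; split=> w /=.
  by move=> kJw; split=> [|j jJ]; apply: kJw; rewrite /= inE ?eqxx// jJ orbT.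
by move=> [kw Jw] j /=; rewrite inE => /predU1P[->//|]; exact: Jw.
Qed.

Let m k := affine_recursion R M c e k.

Let m0 k : 0 <= m k. Proof. exact: affine_recursion_ge0. Qed.

(* The induction needs V k to be uncorrelated with every event determined by
   the variables X j for j >= k. *)
Let integral_cyl k J B : uniq J -> all (leq k) J ->
  (forall j, measurable (B j)) ->
  (\int[P]_(w in cyl J B) (V k w)%:E = (m k)%:E * P (cyl J B))%E.
Proof.
elim: k J B => [|k IH] J B uJ kJ mB.
  exact: (integral_cst P (mcyl J B mB) M%:E).
have kNJ : k \notin J.
  by apply/negP => /(allP kJ); rewrite ltnn.
pose A := cyl J B; have mA : measurable A by exact: mcyl.
pose g w := V k w * \1_A w.
have mg : measurable_fun setT g by apply: measurable_funM => //; exact: measurable_indic.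
have g0 w : 0 <= g w by rewrite mulr_ge0.
have gE S : measurable S ->
    (\int[P]_(w in S) (g w)%:E = \int[P]_(w in S `&` A) (V k w)%:E)%E.
  move=> mS; rewrite integral_mkcondr; apply: eq_integral => w _.
  by rewrite epatch_indic /g EFinM.
(* The expectation of [h (X k)] splits off because the integral of [g] over any event of [X k] is
   [m k * P A] times the probability of that event. *)
have step : (\int[P]_w (h (X k w) * g w)%:E = (m k * fine (P A))%:E * (e k)%:E)%E.
  rewrite -eE; apply: ge0_integral_independent => //.
    by rewrite mulr_ge0// fine_ge0.
  move=> S mS; rewrite gE; last exact: mX.
  (* Since [k] is not in [J], setting the value at [k] to [S] leaves [B] unchanged on [J]. The
     intersection with the event of [X k] is thus a cylinder over [k :: J], to which the induction
     hypothesis applies. *)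
  pose B' j := if j == k then S else B j.
  have mB' j : measurable (B' j) by rewrite /B'; case: ifP.
  have BB' j : j \in J -> B' j = B j.
    by move=> jJ; rewrite /B' ifN//; apply: contraNN kNJ => /eqP <-.
  have cylB' : cyl (k :: J) B' = X k @^-1` S `&` A.
    rewrite cyl_cons {1}/B' eqxx; congr (_ `&` _).
    by apply: eq_bigcapr => j /= jJ; rewrite BB'.
  have kJ' : uniq (k :: J) by rewrite /= kNJ.
  rewrite -cylB' IH//; last first.
    by rewrite /= leqnn; apply: sub_all kJ => j; exact: ltnW.
  rewrite EFinM -muleA; congr (_ * _)%E.
  rewrite (indepX _ _ kJ' mB') big_cons {1}/B' eqxx muleC; congr (_ * _)%E.
  rewrite fineK ?fin_num_measure// (indepX _ _ uJ mB); apply: eq_big_seq => j jJ.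
  by rewrite BB'.
transitivity (\int[P]_(w in A) (h (X k w) * V k w)%:E +
              \int[P]_(w in A) (c k)%:E)%E.
  rewrite -ge0_integralD//.
  - by move=> w _; rewrite lee_fin mulr_ge0.
  - by apply/measurable_EFinP/measurable_funTS/measurable_funM.
  - by move=> w _; rewrite lee_fin.
have -> : (\int[P]_(w in A) (h (X k w) * V k w)%:E =
           \int[P]_w (h (X k w) * g w)%:E)%E.
  rewrite integral_mkcond; apply: eq_integral => w _.
  by rewrite epatch_indic /g mulrA EFinM.
rewrite step (integral_cst P mA (c k)%:E) -/A /= EFinD ge0_muleDl ?lee_fin ?mulr_ge0//.
congr (_ + _)%E; rewrite !EFinM fineK ?fin_num_measure//.
by rewrite muleC muleA.
Qed.

(** The expectations [m k] have a finite sum, which is the integral of the sum of the [V k]; a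
    function with finite integral is finite almost everywhere. *)
Lemma ae_summable_affine_recursion : q < 1 ->
  (\sum_(0 <= k <oo) (c k)%:E < +oo)%E ->
  {ae P, forall w, (\sum_(0 <= k <oo)
    (affine_recursion R M c (fun j => h (X j w)) k)%:E < +oo)%E}.
Proof.
move=> q1 csum.
have EV k : (\int[P]_w (V k w)%:E = (m k)%:E)%E.
  (* The cylinder over no index is the whole space, so this yields the plain expectation. *)
  have := integral_cyl k [::] (fun=> setT) isT isT (fun=> measurableT).
  rewrite /cyl (_ : [set` [::]] = set0) ?bigcap_set0 ?probability_setT ?mule1//.
  by rewrite -subset0 => j.
pose S w := (\sum_(0 <= k <oo) (V k w)%:E)%E.
have mS : measurable_fun setT S.
  by apply: ge0_emeasurable_sum => [k w _ _|k _]; [rewrite lee_fin|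
    exact/measurable_EFinP].
have S0 w : (0 <= S w)%E by apply: nneseries_ge0 => k _ _; rewrite lee_fin.
have ES : (\int[P]_w S w < +oo)%E.
  rewrite integral_nneseries//; last 2 first.
  - by move=> k; exact/measurable_EFinP.
  - by move=> k w _; rewrite lee_fin.
  under eq_eseriesr do rewrite EV.
  pose C := fine (\sum_(0 <= k <oo) (c k)%:E)%E.
  have c0E k : (0 <= (c k)%:E)%E by rewrite lee_fin.
  have CE : (\sum_(0 <= k <oo) (c k)%:E = C%:E)%E.
    by rewrite fineK// ge0_fin_numE// nneseries_ge0.
  apply: (@le_lt_trans _ _ ((M + C) / (1 - q))%:E); last by rewrite ltry.
  apply: lime_le; first by apply: is_cvg_nneseries => k _ _; rewrite lee_fin.
  apply: nearW => n; rewrite sumEFin lee_fin.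
  apply: sum_affine_recursion_le => // [k|{}n].
    by rewrite e0 -lee_fin -eE Ehq.
  by rewrite -lee_fin -sumEFin -CE nneseries_lim_ge.
have intS : P.-integrable setT S.
  apply/integrableP; split => //.
  by under eq_integral do rewrite gee0_abs//.
apply: filterS (integrable_ae _ intS) => // w /(_ I).
by rewrite ge0_fin_numE.
Qed.

End independent_recursion.

(** * Measurability on row vectors and of Lipschitz functions *)

Lemma measurable_coord d (T : measurableType d) n (i : 'I_n) :
  measurable_fun setT (fun x : 'rV[T]_n => x ord0 i).
Proof.
move=> _ Y mY; rewrite setTI; apply: sub_sigma_algebra => /=.
rewrite -bigcup_seq/=; exists i => /=; first by rewrite mem_index_enum.
by exists Y => //; rewrite setTI.
Qed.

Lemma measurable_rowP d d' (T : measurableType d) (T' : measurableType d') n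
    (u : T -> 'rV[T']_n) :
  measurable_fun setT u <->
  forall i, measurable_fun setT (fun w => u w ord0 i).
Proof.
split=> [mu i|mu]; first exact: (measurableT_comp (measurable_coord _ _ _ i) mu).
pose G := \big[setU/set0]_(i < n)
  preimage_set_system setT (fun x : 'rV[T']_n => x ord0 i) measurable.
apply: (@measurability _ _ _ _ _ _ G) => //.
move=> _ [B + <-]; rewrite /G -bigcup_seq => -[i _ [C mC <-]].
by rewrite !setTI -[_ @^-1` _]setTI; exact: mu.
Qed.

Lemma euclidean_norm_le_sum (R : realType) d (u : 'rV[R]_d) :
  euclidean_norm u <= \sum_(l < d) `|u ord0 l|.
Proof.
set S := (X in _ <= X); have S0 : 0 <= S by exact: sumr_ge0.
(* As S is the root of S^2, it suffices that each squared coordinate is at most its absolute value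
   times S. *)
rewrite -(ger0_norm S0) -sqrtr_sqr ler_wsqrtr// expr2 {1}/S mulr_suml.
apply: ler_sum => l _; rewrite -real_normK ?num_real// expr2 ler_wpM2l//.
by rewrite /S (bigD1 l)//= lerDl sumr_ge0.
Qed.

(** The sum of coordinate distances is visibly measurable, and along a basis vector it equals the
    Euclidean distance. *)
Lemma lipschitz_le_sum (R : realType) d (f : 'rV[R]_d -> R) (L : R) :
  0 <= L -> lipschitz_with L f ->
  forall x y, `|f x - f y| <= L * \sum_(l < d) `|x ord0 l - y ord0 l|.
Proof.
move=> L0 fL x y; apply: (le_trans (fL x y)); rewrite ler_wpM2l//.
apply: (le_trans (euclidean_norm_le_sum _ _ _)).
by rewrite le_eqVlt; apply/orP; left; apply/eqP; apply: eq_bigr => l _; rewrite !mxE.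
Qed.

Lemma rat_approx_row (R : realType) d (x : 'rV[R]_d) (e : R) : 0 < e ->
  exists q : 'rV[rat]_d, \sum_(l < d) `|x ord0 l - ratr (q ord0 l)| < e.
Proof.
(* Dividing by [d.+1] keeps the radius positive for [d = 0] and makes the sum of [d] such errors
   strictly less than [e]. *)
move=> e0; have ed0 : 0 < e / d.+1%:R by rewrite divr_gt0.
have ex l : exists r : rat, `|x ord0 l - ratr r| < e / d.+1%:R.
  have /rat_in_itvoo[r] : x ord0 l - e / d.+1%:R < x ord0 l + e / d.+1%:R.
    by rewrite ltrD2l gtrN.
  by rewrite in_itv/= => rx; exists r; rewrite ltr_distlC.
exists (\row_l xget 0 [set r : rat | `|x ord0 l - ratr r| < e / d.+1%:R]).
apply: (@le_lt_trans _ _ (\sum_(l < d) e / d.+1%:R)).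
  apply: ler_sum => l _; rewrite mxE; case: xgetP => [r _ /ltW//|].
  by have [r rx] := ex l => /(_ r).
rewrite sumr_const card_ord -[ltLHS]mulr_natr mulrAC ltr_pdivrMr//.
by rewrite ltr_pM2l// ltr_nat.
Qed.

(* [set x | f x < a] is the union over rational q of the sets
   [set x | f q + L * |x - q|_1 < a]. *)
Lemma measurable_lipschitz (R : realType) d (f : 'rV[R]_d -> R) (L : R) :
  0 < L -> lipschitz_with L f -> measurable_fun setT f.
Proof.
move=> L0 fL.
have fL1 := lipschitz_le_sum _ _ _ _ (ltW L0) fL.
pose emb (q : 'rV[rat]_d) : 'rV[R]_d := map_mx ratr q.
pose F (q : 'rV[rat]_d) (x : 'rV[R]_d) : R :=
  f (emb q) + L * \sum_(l < d) `|x ord0 l - emb q ord0 l|.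
have mF q : measurable_fun setT (F q).
  apply: measurable_funD => //; apply: measurable_funM => //.
  apply: measurable_sum => l; apply: measurableT_comp => //.
  by apply: measurable_funB => //; exact: measurable_coord.
apply: (measurability _ (RGenInftyO.measurableE R)) => _ [_ [a ->] <-].
rewrite setTI.
have -> : f @^-1` `]-oo, a[ = \bigcup_q (F q @^-1` `]-oo, a[).
  apply/seteqP; split=> x /=.
    rewrite in_itv/= => fxa.
    (* At this radius half of the slack [a - f x] pays for f(q) - f(x) and the other half for the
       term L |x - q|_1. *)
    have e0 : 0 < (a - f x) / (2 * L) by rewrite divr_gt0 ?mulr_gt0// subr_gt0.
    have [q qx] := rat_approx_row _ _ x _ e0.
    exists q => //=; rewrite in_itv/= /F.
    have {qx} : L * \sum_(l < d) `|x ord0 l - emb q ord0 l| < (a - f x) / 2.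
      rewrite -ltr_pdivlMl// mulrC -mulrA -invfM; apply: le_lt_trans qx.
      by apply: ler_sum => l _; rewrite mxE.
    have := fL1 x (emb q); rewrite ler_norml => /andP[+ _]; lra.
  move=> [q _ /=]; rewrite !in_itv/=; apply: le_lt_trans.
  by have := fL1 x (emb q); rewrite ler_norml => /andP[_]; rewrite /F; lra.
apply: countable_bigcupT_measurable => [|q]; first exact: countableP.
by rewrite -[_ @^-1` _]setTI; apply: mF => //; exact: measurable_itv.
Qed.

(** * Pathwise estimates and convergence along one noise realization *)

Lemma cvg_row (R : realType) d (u : nat -> 'rV[R]_d) (x : 'rV[R]_d) :
  (forall l, (fun k => u k ord0 l) @ \oo --> x ord0 l) -> u @ \oo --> x.
Proof.
move=> ux; apply/cvg_mx_entourageP => A entA.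
have : \forall k \near \oo, forall l, (x ord0 l, u k ord0 l) \in A.
  apply: filter_forall => l.
  have /cvg_app_entourageP/(_ A entA) := ux l.
  by apply: filterS => k; rewrite inE.
by apply: filterS => k H i j; rewrite (ord1 i); exact: H.
Qed.

Lemma fd_gradient_le (R : realType) d (f : 'rV[R]_d -> R) (L sigma : R) x l :
  0 < L -> lipschitz_with L f -> 0 < sigma ->
  `|fd_gradient f sigma x ord0 l| <= L.
Proof.
move=> L0 fL sigma0; rewrite mxE normrM normfV (gtr0_norm sigma0).
rewrite ler_pdivrMr//; apply: (le_trans (lipschitz_le_sum _ _ _ _ (ltW L0) fL _ _)).
rewrite ler_pM2l// (bigD1 l)//= big1 ?addr0 => [|j jl].
  by rewrite !mxE !eqxx mulr1 addrAC subrr add0r gtr0_norm.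
by rewrite !mxE (negbTE jl) andbF mulr0 addr0 subrr normr0.
Qed.

(** The weights are positive, so the consensus point is a convex combination of the particles and
    its distance to particle [i] is at most the weighted mean of the gaps. *)
Lemma consensus_point_le (R : realType) d N (f : 'rV[R]_d -> R) (beta : R)
    (x : 'I_N -> 'rV[R]_d) (i : 'I_N) l (v : R) :
  (forall j, `|x j ord0 l - x i ord0 l| <= v) ->
  `|x i ord0 l - consensus_point f beta x ord0 l| <= v.
Proof.
move=> xv; pose w j := expR (- (beta * f (x j))).
have w0 j : 0 < w j by exact: expR_gt0.
have W0 : 0 < \sum_(j < N) w j.
  by rewrite (bigD1 i)//= ltr_pwDl// sumr_ge0// => j _; exact: ltW.
rewrite distrC.
have -> : consensus_point f beta x ord0 l - x i ord0 l =
    (\sum_(j < N) w j)^-1 * \sum_(j < N) w j * (x j ord0 l - x i ord0 l).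
  rewrite mxE summxE.
  under [X in _ = _ * X]eq_bigr do rewrite mulrBr.
  rewrite big_split/= sumrN -mulr_suml mulrBr mulKf ?gt_eqF//.
  by congr (_ * _ - _); apply: eq_bigr => j _; rewrite mxE.
rewrite normrM gtr0_norm ?invr_gt0// ler_pdivrMl// mulr_suml.
apply: (le_trans (ler_norm_sum _ _ _)); apply: ler_sum => j _.
by rewrite normrM gtr0_norm// ler_wpM2l// ltW.
Qed.

Section trajectory.
Context (R : realType) (d N : nat) (f : 'rV[R]_d -> R)
  (L beta lambda sigma : R) (alpha : nat -> R) (x0 : 'I_N -> 'rV[R]_d)
  (e : nat -> 'rV[R]_d) (l : 'I_d).
Hypotheses (L0 : 0 < L) (fL : lipschitz_with L f) (sigma0 : 0 < sigma)
  (alpha0 : forall k, 0 <= alpha k).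

Let x k i := escbo f beta lambda sigma alpha x0 e k i.
Let a k := `|1 - lambda - e k ord0 l|.
Let v := affine_recursion R
  (\sum_(i < N) \sum_(j < N) `|x0 i ord0 l - x0 j ord0 l|)
  (fun k => 2 * L * alpha k) a.

Let gE k i := fd_gradient f sigma (x k i) ord0 l.

Let stepE k i : x k.+1 i ord0 l = x k i ord0 l -
  (lambda + e k ord0 l) * (x k i ord0 l - consensus_point f beta (x k) ord0 l) -
  alpha k * gE k i.
Proof.
rewrite /gE /x /= /escbo_step -/x; move: (consensus_point _ _ _) => c.
by move: (fd_gradient _ _ _) => g; rewrite !mxE; ring.
Qed.

Let gap_le k i j : `|x k i ord0 l - x k j ord0 l| <= v k.
Proof.
elim: k i j => [|k IH] i j.
  (* The initial value of [v] is the sum of all initial gaps, hence bounds each of them. *)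
  rewrite /v /= (bigD1 i)//= (bigD1 j)//= -addrA lerDl addr_ge0//.
    exact: sumr_ge0.
  by apply: sumr_ge0 => i' _; exact: sumr_ge0.
have -> : x k.+1 i ord0 l - x k.+1 j ord0 l =
    (1 - lambda - e k ord0 l) * (x k i ord0 l - x k j ord0 l) -
    alpha k * (gE k i - gE k j).
  by rewrite !stepE; ring.
apply: (le_trans (ler_normB _ _)); rewrite !normrM lerD// ?ler_wpM2l//.
rewrite (ger0_norm (alpha0 k)) [leRHS]mulrC ler_wpM2l//.
apply: (le_trans (ler_normB _ _)); rewrite mulr_natl mulr2n lerD//;
  exact: fd_gradient_le.
Qed.

Let increment_le k i : `|x k.+1 i ord0 l - x k i ord0 l| <= v k + v k.+1.
Proof.
set z := x k i ord0 l - consensus_point f beta (x k) ord0 l.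
(* Splitting -(lambda + eta) z as -z + (1 - lambda - eta) z brings out the factor of the recursion:
   the first term is at most [v k], and the remaining two together at most [v k.+1]. *)
have -> : x k.+1 i ord0 l - x k i ord0 l =
    - z + (1 - lambda - e k ord0 l) * z - alpha k * gE k i.
  by rewrite stepE -/z; ring.
have zv : `|z| <= v k by apply: consensus_point_le.
have gL : `|gE k i| <= L by exact: fd_gradient_le.
apply: (le_trans (ler_normB _ _)); apply: (le_trans (lerD (ler_normD _ _) (lexx _))).
rewrite normrN !normrM -addrA lerD//= (ger0_norm (alpha0 k)) lerD//.
  by rewrite ler_wpM2l.
rewrite mulrC ler_wpM2r//; apply: (le_trans gL).
by apply: ler_peMl; [exact: ltW|rewrite ler1n].
Qed.

(** Absolutely summable increments make each particle converge; the gaps tend to 0 as they are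
    dominated by the terms of a convergent series, so the limits coincide. *)
Lemma cvg_escbo_coord : cvgn (series v) ->
  exists y : R, forall i, (fun k => x k i ord0 l) @ \oo --> y.
Proof.
move=> cv.
have v0 k : 0 <= v k.
  apply: affine_recursion_ge0 => [|n|n]; last exact: normr_ge0.
    by apply: sumr_ge0 => i _; exact: sumr_ge0.
  by apply: mulr_ge0 => //; apply: mulr_ge0 => //; exact: ltW.
have cx i : cvgn (fun k => x k i ord0 l).
  pose u k := x k.+1 i ord0 l - x k i ord0 l.
  have cu : cvgn (series u).
    apply: normed_cvg; apply: (@series_le_cvg _ _ (fun k => v k + v k.+1)) => //.
    - by move=> k; exact: normr_ge0.
    - by move=> k; rewrite addr_ge0.
    - by move=> k; exact: increment_le.
    (* The sum of the [v k.+1] is the shifted series of [v] without its initial term. *)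
    - rewrite (_ : series _ = series v \+ (fun n => series v n.+1 - v 0%N)).
        apply: is_cvgD => //; apply: is_cvgB; last exact: is_cvg_cst.
        by apply/cvg_ex; exists (limn (series v)); rewrite cvg_shiftS.
      apply/funext => n /=; rewrite /series/= big_split/=; congr (_ + _).
      by rewrite big_nat_recl//= addrC addKr.
  rewrite (_ : (fun k => _) = series u \+ cst (x 0%N i ord0 l)).
    by apply: is_cvgD => //; exact: is_cvg_cst.
  by apply/funext => k; rewrite /= /series/= telescope_sumr// subrK.
have [N0|N0] := posnP N.
  (* Without particles the claim is vacuous and 0 is a placeholder. *)
  by exists 0 => i; have := ltn_ord i; rewrite {2}N0.
pose i0 := Ordinal N0; exists (limn (fun k => x k i0 ord0 l)) => i.
rewrite (_ : (fun k => _) =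
  (fun k => x k i0 ord0 l) \+ (fun k => x k i ord0 l - x k i0 ord0 l)); last first.
  by apply/funext => k /=; rewrite addrC subrK.
rewrite -[X in _ --> X]addr0; apply: cvgD; first exact: cx.
apply/norm_cvg0P; apply: (squeeze_cvgr _ (cvg_cst 0) (cvg_series_cvg_0 cv)).
by apply: nearW => k; rewrite normr_ge0 gap_le.
Qed.

End trajectory.

(** * Measurability of the iterates *)

(** This is what makes the limit a random vector. *)
Lemma measurable_escbo d (T : measurableType d) (R : realType) n N
    (f : 'rV[R]_n -> R) (beta lambda sigma : R) (alpha : nat -> R)
    (x0 : 'I_N -> 'rV[R]_n) (eta : nat -> T -> 'rV[R]_n) :
  measurable_fun setT f -> (forall k, measurable_fun setT (eta k)) ->
  forall k i, measurable_fun setT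
    (fun w => escbo f beta lambda sigma alpha x0 (fun j => eta j w) k i).
Proof.
move=> mf meta; elim=> [|k IH] i; first exact: measurable_cst.
pose x w := escbo f beta lambda sigma alpha x0 (fun j => eta j w) k.
have mx j l : measurable_fun setT (fun w => x w j ord0 l).
  exact: (measurable_rowP _ _ _ _ _ _).1 (IH j) l.
have mweight j : measurable_fun setT (fun w => expR (- (beta * f (x w j)))).
  apply: measurableT_comp => //; apply: measurableT_comp => //.
  by apply: measurable_funM => //; exact: (measurableT_comp mf (IH j)).
have mcons l : measurable_fun setT (fun w => consensus_point f beta (x w) ord0 l).
  (* The inverse of the nonnegative total weight is expressed as its power with exponent -1, whose
     measurability is [measurable_powR]. *)
  rewrite (_ : (fun w => _) = (fun w =>
    (\sum_(j < N) expR (- (beta * f (x w j)))) `^ (-1) *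
    \sum_(j < N) expR (- (beta * f (x w j))) * x w j ord0 l)); last first.
    apply/funext => w; rewrite mxE summxE powR_inv1; last first.
      by apply: sumr_ge0 => j _; exact: expR_ge0.
    congr (_ * _).
    by apply: eq_bigr => j _; rewrite mxE.
  apply: measurable_funM.
    by apply: (measurableT_comp (measurable_powR _)); exact: measurable_sum.
  by apply: measurable_sum => j; exact: measurable_funM.
have mgrad l : measurable_fun setT (fun w => fd_gradient f sigma (x w i) ord0 l).
  rewrite (_ : (fun w => _) = (fun w =>
    (f (x w i + sigma *: delta_mx ord0 l) - f (x w i)) / sigma)); last first.
    by apply/funext => w; rewrite mxE.
  apply: measurable_funM => //; apply: measurable_funB.
    apply: (measurableT_comp mf); apply/measurable_rowP => j.
    by under eq_fun do rewrite mxE; exact: measurable_funD.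
  exact: (measurableT_comp mf (IH i)).
have meta' l : measurable_fun setT (fun w => eta k w ord0 l).
  exact: (measurable_rowP _ _ _ _ _ _).1 (meta k) l.
apply/measurable_rowP => l.
rewrite (_ : (fun w => _) = (fun w => x w i ord0 l -
  lambda * (x w i ord0 l - consensus_point f beta (x w) ord0 l) -
  (x w i ord0 l - consensus_point f beta (x w) ord0 l) * eta k w ord0 l -
  alpha k * fd_gradient f sigma (x w i) ord0 l)); last first.
  apply/funext => w; rewrite /= /escbo_step -/(x w).
  move: (consensus_point _ _ _) (fd_gradient _ _ _) => c g.
  by rewrite !mxE.
have mgap : measurable_fun setT
    (fun w => x w i ord0 l - consensus_point f beta (x w) ord0 l).
  exact: measurable_funB.
by do 2 (apply: measurable_funB; last exact: measurable_funM);
  apply: measurable_funB => //; exact: measurable_funM.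
Qed.

(** * Mean contraction factor and almost sure convergence *)

Lemma gaussian_factor_abs_le d (T : measurableType d) (R : realType)
    (P : probability T R) (X : T -> R) (mu delta s : R) :
  measurable_fun setT X -> 0 <= delta -> delta < s ->
  (forall A, measurable A -> pushforward P X A = gaussian_law 0 delta A) ->
  (\int[P]_w `|mu - X w|%:E <= (`|mu| + s)%:E)%E.
Proof.
move=> mX delta0 deltas law.
have mXE : measurable_fun setT (fun w => `|X w|%:E).
  by apply/measurable_EFinP; exact: measurableT_comp.
apply: (@le_trans _ _ (\int[P]_w (`|mu|%:E + `|X w|%:E))%E).
  apply: ge0_le_integral => //.
  - by apply/measurable_EFinP; apply: measurableT_comp => //; exact: measurable_funB.
  - exact: emeasurable_funD.
  - by move=> w _; rewrite -EFinD lee_fin ler_normB.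
rewrite ge0_integralD//= (integral_cst P measurableT `|mu|%:E).
rewrite [X in (_ * X + _)%E](_ : _ = 1%E) ?mule1 ?EFinD; last exact: probability_setT.
apply: leeD2l.
exact: gaussian_law_abs_le law.
Qed.

Lemma is_cvg_series_nneseries_lty (R : realType) (u : nat -> R) :
  (forall k, 0 <= u k) -> (\sum_(0 <= k <oo) (u k)%:E < +oo)%E ->
  cvgn (series u).
Proof.
move=> u0 ub; apply: nondecreasing_is_cvgn.
  by apply/nondecreasing_seqP => n; rewrite -subr_ge0 seriesSB.
have u0E k : (0 <= (u k)%:E)%E by rewrite lee_fin.
exists (fine (\sum_(0 <= k <oo) (u k)%:E)%E) => _ [n _ <-].
rewrite -lee_fin fineK; last by rewrite ge0_fin_numE// nneseries_ge0.
by rewrite /series/= -sumEFin nneseries_lim_ge.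
Qed.

Theorem theorem4p6 (R : realType) (disp : measure_display)
  (T : measurableType disp) (P : probability T R) (d N : nat)
  (hd : (0 < d)%N) (hN : (0 < N)%N)
  (f : 'rV[R]_d -> R) (f_ge0 : forall x, 0 <= f x)
  (Lf : R) (Lf_gt0 : 0 < Lf) (f_lip : lipschitz_with Lf f)
  (beta lambda delta sigma : R)
  (beta_gt0 : 0 < beta) (lambda_gt0 : 0 < lambda)
  (delta_ge0 : 0 <= delta) (sigma_gt0 : 0 < sigma)
  (alpha : nat -> R) (alpha_ge0 : forall k, 0 <= alpha k)
  (x0 : 'I_N -> 'rV[R]_d)
  (eta : nat -> {RV P >-> 'rV[R]_d}) (eta_noise : escbo_noise delta eta)
  (contraction : (1 - lambda) ^+ 2 + delta ^+ 2 < 2^-1)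
  (alpha_summable : (\sum_(0 <= k <oo) (alpha k)%:E < +oo)%E) :
  exists x_infty : {RV P >-> 'rV[R]_d},
    forall i : 'I_N,
      {ae P, forall w,
        (fun k => escbo f beta lambda sigma alpha x0 (fun j => eta j w) k i)
          @ \oo --> x_infty w}.
Proof.
have [law _ indep] := eta_noise.
have mf := measurable_lipschitz _ _ _ _ Lf_gt0 f_lip.
have meta k : measurable_fun setT (eta k) by exact: measurable_funP.
pose x w k i := escbo f beta lambda sigma alpha x0 (fun j => eta j w) k i.
have mx k i l : measurable_fun setT (fun w => x w k i ord0 l).
  apply: (measurable_rowP _ _ _ _ _ _).1.
  exact: (measurable_escbo _ _ _ _ _ _ _ _ _ _ _ eta).
pose mu := 1 - lambda.
(* By convexity (|mu| + delta)^2 <= 2 (mu^2 + delta^2), which is below 1; this is where the constant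
   1/2 enters. *)
have mu_delta : `|mu| + delta < 1.
  have : `|mu| ^+ 2 = mu ^+ 2 by exact: real_normK (num_real _).
  have := normr_ge0 mu; move: contraction; rewrite -/mu => c1 c2 c3.
  have c4 : 0 <= (`|mu| - delta) ^+ 2 by exact: sqr_ge0.
  rewrite -(ltr_pXn2r (n := 2)) ?nnegrE ?addr_ge0// expr1n.
  by move: c4; rewrite sqrrB sqrrD c3; lra.
(* The midpoint of [delta] and 1 - |mu| leaves room on both sides: [s] exceeds [delta], as the
   moment bound requires, while |mu| + s stays below 1. *)
pose s := (delta + (1 - `|mu|)) / 2.
have deltas : delta < s by rewrite /s; lra.
have q1 : `|mu| + s < 1 by rewrite /s; lra.
pose c k := 2 * Lf * alpha k.
have L2 : 0 <= 2 * Lf by rewrite mulr_ge0// ltW.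
have c0 k : 0 <= c k by rewrite mulr_ge0.
have csum : (\sum_(0 <= k <oo) (c k)%:E < +oo)%E.
  under eq_eseriesr do rewrite EFinM.
  rewrite nneseriesZl => [|k _]; last by rewrite lee_fin.
  by rewrite lte_mul_pinfty// lee_fin.
pose h (l : 'I_d) (y : 'rV[R]_d) := `|mu - y ord0 l|.
pose M l := \sum_(i < N) \sum_(j < N) `|x0 i ord0 l - x0 j ord0 l|.
have cvgx l : {ae P, forall w, exists y : R,
    forall i, (fun k => x w k i ord0 l) @ \oo --> y}.
  have mh : measurable_fun setT (h l).
    apply: measurableT_comp => //; apply: measurable_funB => //.
    exact: measurable_coord.
  have M0 : 0 <= M l by apply: sumr_ge0 => i _; exact: sumr_ge0.
  have Eh k : (\int[P]_w (h l (eta k w))%:E <= (`|mu| + s)%:E)%E.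
    apply: (gaussian_factor_abs_le _ _ _ P (fun w => eta k w ord0 l) _ delta) => //.
      exact: (measurable_rowP _ _ _ _ _ _).1 (meta k) l.
    by move=> A mA; exact: law.
  have := ae_summable_affine_recursion _ _ _ _ _ P eta (h l) (M l) _ c indep mh
    (fun y => normr_ge0 _) M0 c0 Eh q1 csum.
  apply: filterS => w sumw.
  apply: (cvg_escbo_coord _ _ _ f Lf) => //.
  apply: is_cvg_series_nneseries_lty => // k.
  by apply: affine_recursion_ge0 => // j; exact: normr_ge0.
pose i0 := Ordinal hN.
(* The upper limit exists at every [w] and is measurable; [fine] makes it real where it is infinite,
   and on the almost sure event it is the true limit. *)
pose y w : 'rV[R]_d := \row_l fine (limn_esup (fun k => (x w k i0 ord0 l)%:E)).
have my : measurable_fun setT y.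
  apply/measurable_rowP => l; under eq_fun do rewrite mxE.
  apply: measurableT_comp => //; apply: measurable_fun_limn_esup => k.
  exact/measurable_EFinP.
pose yRV : {mfun T >-> 'rV[R]_d} := HB.pack y (isMeasurableFun.Build _ _ _ _ _ my).
exists yRV => i /=.
(* Finitely many coordinates share one almost sure event. *)
have : {ae P, forall w, forall l, exists z : R,
    forall i, (fun k => x w k i ord0 l) @ \oo --> z}.
  exact: filter_forall.
apply: filterS => w xw; apply: cvg_row => l.
have [z xz] := xw l; rewrite mxE.
have -> : limn_esup (fun k => (x w k i0 ord0 l)%:E) = z%:E.
  by apply: (cvg_limn_einf_sup _).2; apply/cvg_EFin; [exact: nearW|exact: xz].
exact: xz.
Qed.
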